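(* Let $c>0$, $x>0$, $\alpha\in(-1,0]$, and let $g:[0,\infty)\to\mathbb R$ satisfy $\lim_{t\to\infty}\frac{g(t)}{t^{\frac1{1-\alpha}}}=0$. Let $y$, with $y(t)>0$ for all $t\ge0$, be a solution of $$y(t)=x+c\int_0^t|y(s)|^\alpha ds+g(t),\quad t\ge0,$$ such that $$\liminf_{t\to\infty}y(t)>0.$$ Then $$\lim_{t\to\infty}\frac{y(t)}{(c(1-\alpha)t)^{\frac1{1-\alpha}}}=1.$$
   Context: All functions ($y$, $g$) are assumed to be measurable and locally bounded on $[0,\infty)$. *)

(* Defs.v *)
From HB Require Import structures.
From mathcomp Require Import all_boot all_order all_algebra.
From mathcomp Require Import all_classical all_reals all_analysis.

Set Implicit Arguments.
Unset Strict Implicit.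
Unset Printing Implicit Defensive.

Import Order.TTheory GRing.Theory Num.Theory.
Import numFieldNormedType.Exports.

Local Open Scope classical_set_scope.
Local Open Scope ring_scope.

(* The real line with the Lebesgue sigma-algebra, i.e. the domain of
   [completed_lebesgue_measure]; the library's default measurable structure
   on R is the smaller Borel one. *)
Notation lebesgueType R := (caratheodory_type (@wlength R idfun)^*%mu).

(* Functions on [0, +oo[ are represented by total functions on R, about whose
   values on ]-oo, 0[ nothing is assumed. *)
Definition halfline {R : realType} : set R := `[0, +oo[.

Definition measurable_locally_bounded {R : realType} (f : R -> R) : Prop :=
  measurable_fun (halfline : set (lebesgueType R)) (f : lebesgueType R -> R) /\
  [locally [bounded f s | s in halfline]].

(* Since c > 0, the integrand is nonnegative and the other terms are finite,
   this extended-real equation includes the finiteness of the integral. *)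
Definition is_solution {R : realType} (x c alpha : R) (g y : R -> R) : Prop :=
  forall t : R, 0 <= t ->
    ((y t)%:E = x%:E
       + c%:E * \int[completed_lebesgue_measure]_(s in `[0%R, t])
                  (`|y s| `^ alpha)%:E
       + (g t)%:E)%E.

(* Main.v *)
Require Import Defs.
From mathcomp Require Import all_boot all_order all_algebra.
From mathcomp Require Import all_classical all_reals all_analysis.
From mathcomp Require Import measurable_realfun ring lra.

Set Implicit Arguments.
Unset Strict Implicit.
Unset Printing Implicit Defensive.

Import Order.TTheory GRing.Theory Num.Theory.
Import numFieldNormedType.Exports.

Local Open Scope classical_set_scope.
Local Open Scope ring_scope.

(** Put [q = 1 - alpha], which lies in [1, 2), and [V = y - g], the increasing
part [x + c * \int_0^t y^alpha] of the solution.  Formally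
[V' = c * y^(1 - q)].  If [y] can be replaced by [V], this says
[(V^q)' = c * q], hence [V^q ~ c * q * t], and the claim follows by taking
[q]-th roots.  The replacement is legitimate as soon as [V] dominates
[g = o(t^(1/q))], so the point is to bound [V] below by a multiple of [t^(1/q)].

- Upper bound: [V^q = O(t)].  While [V] exceeds [t^(1/q)] it controls [g], so
  [y >= V / 2] and [V^q] grows by a bounded amount per unit of time; while
  [V] is below that threshold, [V^q = O(t)] trivially.  The positive lower
  limit of [y] prevents jumps from the second regime ([Vq_le_linear]).
- Lower bound: the upper bound gives [y = O(t^(1/q))], and feeding this into
  [V' = c * y^(1 - q)], whose right-hand side is nonincreasing in [y], gives
  [V >= m * t^(1/q)] for some [m > 0] ([V_ge_root]).
- Conclusion: now [y / V] and [V(t + 1) / V(t)] tend to [1], so the increments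
  [V(t + 1)^q - V(t)^q] tend to [c * q] ([Vq_unit_step]), and summing them gives
  [V(t)^q / t --> c * q] ([Vq_asymptotic]).

No differential equation is used: [V] is only known through the increments
[V t - V s], which are bounded by the length [t - s] times bounds of the
integrand on [`]s, t]].  All the limits are expressed multiplicatively, as
enclosures between [r^-k] and [r^k] for arbitrary [r > 1], so that real powers
with exponent at most [1] only shrink the enclosures. *)

(** * Increments of the integral term *)

Lemma lebesgueType_measurable_itv {R : realType} (i : interval R) :
  measurable ([set` i] : set (lebesgueType R)).
Proof. apply: sub_caratheodory; exact: measurable_itv. Qed.

Lemma completed_lebesgue_measure_itvoc {R : realType} (s t : R) : s <= t ->
  completed_lebesgue_measure (`]s, t] : set R) = (t - s)%:E.
Proof.
move=> st; rewrite -[LHS]/(lebesgue_measure (`]s, t] : set R)).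
rewrite lebesgue_measure_itv/= lte_fin -EFinB.
by case: ltP => // ts; rewrite (_ : t = s) ?subrr//; lra.
Qed.

Section Increments.
Context {R : realType} (x c alpha : R) (g y : R -> R).
Hypotheses (c_gt0 : 0 < c)
  (y_meas : measurable_fun (halfline : set (lebesgueType R))
              (y : lebesgueType R -> R))
  (y_sol : is_solution x c alpha g y).

Local Notation rate := (fun s : lebesgueType R => (`|y s| `^ alpha)%:E).

Let rate_meas : measurable_fun (halfline : set (lebesgueType R)) rate.
Proof.
apply/measurable_EFinP.
apply: (@measurableT_comp _ _ _ _ _ _ (fun z : R => z `^ alpha)).
  exact: measurable_powR.
exact: measurableT_comp.
Qed.

Let rate_meas_itv (s t : R) : 0 <= s ->
  measurable_fun (`]s, t]%classic : set (lebesgueType R)) rate.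
Proof.
move=> s_ge0; apply: measurable_funS rate_meas.
  exact: lebesgueType_measurable_itv (Interval (BLeft 0) +oo%O).
move=> r; rewrite /halfline/= !in_itv/= andbT => /andP[sr _].
exact: le_trans s_ge0 (ltW sr).
Qed.

(** Subtracting the integral equation at [s] and [t] is licit because the
equation itself forces the extended-real integrals to be finite. *)
Lemma solution_increment (s t : R) : 0 <= s -> s <= t ->
  (y t - g t)%:E = ((y s - g s)%:E +
    c%:E * \int[completed_lebesgue_measure]_(r in `]s, t]) rate r)%E.
Proof.
move=> s_ge0 st.
have split_itv : `[0, t]%classic = `[0, s]%classic `|` `]s, t]%classic :> set R.
  apply/seteqP; split => r /=; rewrite !in_itv/=.
    by case: (leP r s) => rs /andP[-> rt]; [left|right].
  by case => /andP[h1 h2]; lra.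
pose I (D : interval R) :=
  (\int[completed_lebesgue_measure]_(r in [set` D]) rate r)%E.
have I_ge0 D : (0 <= I D)%E.
  by apply: integral_ge0 => r _; rewrite lee_fin powR_ge0.
have sum_itv : (I `[0%R, t] = I `[0%R, s] + I `]s, t])%E.
  rewrite /I split_itv ge0_integral_setU.
  - by [].
  - exact: lebesgueType_measurable_itv.
  - exact: lebesgueType_measurable_itv.
  - rewrite -split_itv; apply: measurable_funS rate_meas.
      exact: lebesgueType_measurable_itv.
    by move=> r; rewrite /halfline/= !in_itv/= andbT => /andP[].
  - by move=> r _; rewrite lee_fin powR_ge0.
  - apply/disj_setPRL => r /=; rewrite !in_itv/= => /andP[sr _] /andP[_ rs].
    by have := lt_le_trans sr rs; rewrite ltxx.
have yt : ((y t)%:E = x%:E + c%:E * I `[0%R, t] + (g t)%:E)%E.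
  exact: y_sol (le_trans s_ge0 st).
have ys : ((y s)%:E = x%:E + c%:E * I `[0%R, s] + (g s)%:E)%E.
  exact: y_sol.
change (integral _ _ _) with (I `]s, t]); move: yt ys; rewrite sum_itv.
move: (I_ge0 `[0%R, s]) (I_ge0 `]s, t]).
case: (I `[0%R, s]) => [a||//] _; case: (I `]s, t]) => [b||//] _ /=.
- move=> [->] [->]; congr EFin; ring.
- by rewrite gt0_muley ?lte_fin.
- by rewrite gt0_muley ?lte_fin.
- by rewrite gt0_muley ?lte_fin.
Qed.

Lemma solution_increment_le (s t A : R) : 0 <= s -> s <= t ->
  (forall r, s < r <= t -> `|y r| `^ alpha <= A) ->
  (y t - g t) - (y s - g s) <= c * (A * (t - s)).
Proof.
move=> s_ge0 st yA; rewrite lerBlDl -lee_fin (solution_increment s_ge0 st).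
rewrite [leRHS]EFinD leeD2l// EFinM lee_pmul2l// EFinM.
rewrite -(completed_lebesgue_measure_itvoc st).
rewrite -integral_cst; last exact: lebesgueType_measurable_itv.
apply: ge0_le_integral.
- exact: lebesgueType_measurable_itv.
- by move=> r _; rewrite lee_fin powR_ge0.
- exact: rate_meas_itv.
- exact: measurable_cst.
- by move=> r /=; rewrite in_itv/= lee_fin; exact: yA.
Qed.

Lemma solution_increment_ge (s t A : R) : 0 <= s -> s <= t -> 0 <= A ->
  (forall r, s < r <= t -> A <= `|y r| `^ alpha) ->
  c * (A * (t - s)) <= (y t - g t) - (y s - g s).
Proof.
move=> s_ge0 st A_ge0 yA.
rewrite lerBrDl -lee_fin (solution_increment s_ge0 st).
rewrite [leLHS]EFinD leeD2l// EFinM lee_pmul2l// EFinM.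
rewrite -(completed_lebesgue_measure_itvoc st).
rewrite -integral_cst; last exact: lebesgueType_measurable_itv.
apply: ge0_le_integral.
- exact: lebesgueType_measurable_itv.
- by move=> r _; rewrite lee_fin.
- exact: measurable_cst.
- exact: rate_meas_itv.
- by move=> r /=; rewrite in_itv/= lee_fin; exact: yA.
Qed.

End Increments.

(** * Auxiliary facts on the half-line and on powers *)

Lemma near_pinfty_forall_ge {R : realType} (P : R -> Prop) :
  (\forall t \near +oo, P t) -> \forall t \near +oo, forall s, t <= s -> P s.
Proof.
move=> [M [Mreal MP]]; exists M; split => // t Mt s ts.
by apply: MP; exact: lt_le_trans Mt ts.
Qed.

(** Induction along unit steps starting anywhere in [`[T, T + 1]]; it turns
bounds on [f (t + 1) - f t] into linear bounds on [f t] for real [t], with no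
sampling at integers. *)
Lemma unit_step_ind {R : realType} (P : R -> Prop) (T : R) :
  (forall t, T <= t <= T + 1 -> P t) ->
  (forall t, T <= t -> P t -> P (t + 1)) -> forall t, T <= t -> P t.
Proof.
move=> P0 PS t Tt.
have [n tn] : exists n : nat, t <= T + n%:R.
  exists (Num.truncn (t - T)).+1.
  have /ltW := truncnS_gt (t - T); lra.
elim: n t Tt tn => [|n IHn] t Tt tn.
  by apply: P0; rewrite Tt (le_trans tn)// lerD2l.
have [tT1|T1t] := leP t (T + 1); first by apply: P0; rewrite Tt.
rewrite -(subrK 1 t); apply: PS; first by lra.
by apply: IHn; [lra|rewrite -natr1 in tn; lra].
Qed.

(** The mean value theorem for [s^q], whose derivative is nondecreasing. *)
Lemma powR_increment_bounds {R : realType} (q a b : R) :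
  1 <= q -> 0 < a -> a <= b ->
  q * a `^ (q - 1) * (b - a) <= b `^ q - a `^ q <= q * b `^ (q - 1) * (b - a).
Proof.
move=> q_ge1 a_gt0 ab.
have d s : a <= s -> is_derive s (1 : R) (fun z => z `^ q) (q * s `^ (q - 1)).
  by move=> ?; apply: is_derive1_powR; lra.
have [s|| s] := MVT_segment ab (f := fun z => z `^ q)
  (df := fun s => q * s `^ (q - 1)).
- by rewrite in_itv/= => /andP[as_ _]; apply: d; exact: ltW.
- apply: derivable_within_continuous => s; rewrite in_itv/= => /andP[as_ _].
  by have := d _ as_; case.
rewrite in_itv/= => /andP[as_ sb] ->.
have ba : 0 <= b - a by lra.
have q0 : 0 <= q by lra.
apply/andP; split; rewrite ler_wpM2r// ler_wpM2l// ge0_ler_powR ?nnegrE//; lra.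
Qed.

Lemma powR_ratio {R : realType} (q B r : R) : 0 < B -> 0 < r ->
  (r * B) `^ (q - 1) * B `^ (1 - q) = r `^ (q - 1).
Proof.
move=> B_gt0 r_gt0; rewrite powRM ?ltW// -mulrA -powRD.
  by rewrite addrA subrK subrr powRr0 mulr1.
by rewrite (gt_eqF B_gt0) implybT.
Qed.

(** * Growth of the increasing part of the solution *)

Section IncreasingPart.
(* [V_step_le] and [V_step_ge] are the two halves of the integral form of
   [V' = c * y^(1 - q)]. *)
Context {R : realType} (c q : R) (V y : R -> R).
Local Notation b := (1 / q).
Hypotheses (c_gt0 : 0 < c) (q_ge1 : 1 <= q) (q_le2 : q <= 2).
Hypotheses (V_gt0 : forall t, 0 <= t -> 0 < V t)
  (V_mono : forall s t, 0 <= s -> s <= t -> V s <= V t).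
Hypothesis V_step_le : forall s t B, 0 <= s -> s <= t -> 0 < B ->
  (forall r, s < r <= t -> B <= y r) ->
  V t - V s <= c * (B `^ (1 - q) * (t - s)).
Hypothesis V_step_ge : forall s t B, 0 <= s -> s <= t ->
  (forall r, s < r <= t -> y r <= B) ->
  c * (B `^ (1 - q) * (t - s)) <= V t - V s.
Hypothesis y_away0 : exists2 d : R, 0 < d & \forall t \near +oo, d <= y t.
Hypothesis y_near_V : forall e : R, 0 < e ->
  \forall t \near +oo, `|y t - V t| <= e * t `^ b.

Let q_gt0 : 0 < q. Proof. exact: lt_le_trans ltr01 q_ge1. Qed.
Let b_gt0 : 0 < b. Proof. by rewrite div1r invr_gt0. Qed.
Let bq : b * q = 1. Proof. by rewrite div1r mulVf// gt_eqF. Qed.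
Let qb : q * b = 1. Proof. by rewrite mulrC. Qed.
Let powR_root z : 0 <= z -> (z `^ q) `^ b = z.
Proof. by move=> z_ge0; rewrite -powRrM qb powRr1. Qed.
Let root_powR z : 0 <= z -> (z `^ b) `^ q = z.
Proof. by move=> z_ge0; rewrite -powRrM bq powRr1. Qed.
Let b_le1 : b <= 1. Proof. by rewrite div1r invf_le1. Qed.

Let V_unit_step_le t B : 0 <= t -> 0 < B ->
  (forall s, t < s <= t + 1 -> B <= y s) -> V (t + 1) - V t <= c * B `^ (1 - q).
Proof.
move=> t_ge0 B_gt0 By.
have -> : B `^ (1 - q) = B `^ (1 - q) * (t + 1 - t) by ring.
by apply: V_step_le => //; lra.
Qed.

Let V_unit_step_ge t B : 0 <= t ->
  (forall s, t < s <= t + 1 -> y s <= B) -> c * B `^ (1 - q) <= V (t + 1) - V t.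
Proof.
move=> t_ge0 By.
have -> : B `^ (1 - q) = B `^ (1 - q) * (t + 1 - t) by ring.
by apply: V_step_ge => //; lra.
Qed.

(** The integral form of [(V^q)' = c * q * (V / y)^(q - 1)] over a unit of time:
if [V / y] stays below [r], then [V^q] grows by at most
[c * q * r^(q - 1)]. *)
Let Vq_unit_step_le t B r : 0 <= t -> 0 < B -> 0 < r ->
  (forall s, t < s <= t + 1 -> B <= y s) -> V (t + 1) <= r * B ->
  V (t + 1) `^ q <= V t `^ q + c * q * r `^ (q - 1).
Proof.
move=> t_ge0 B_gt0 r_gt0 By VrB.
have VV : V t <= V (t + 1) by apply: V_mono; lra.
have /andP[_ dVq] := powR_increment_bounds q_ge1 (V_gt0 t_ge0) VV.
rewrite -lerBlDl (le_trans dVq)// -(powR_ratio q B_gt0 r_gt0).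
rewrite [leRHS](_ : _ = q * (r * B) `^ (q - 1) * (c * B `^ (1 - q)));
  last by ring.
apply: ler_pM.
- by rewrite mulr_ge0 ?powR_ge0 ?ltW.
- by rewrite subr_ge0.
- rewrite ler_wpM2l ?(ltW q_gt0)// ge0_ler_powR ?nnegrE ?subr_ge0//.
    by apply/ltW/V_gt0; lra.
  by rewrite mulr_ge0 ?ltW.
- exact: V_unit_step_le.
Qed.

Let Vq_unit_step_ge t B r : 0 <= t -> 0 < B -> 0 < r ->
  (forall s, t < s <= t + 1 -> y s <= B) -> r * B <= V t ->
  V t `^ q + c * q * r `^ (q - 1) <= V (t + 1) `^ q.
Proof.
move=> t_ge0 B_gt0 r_gt0 By rBV.
have VV : V t <= V (t + 1) by apply: V_mono; lra.
have /andP[dVq _] := powR_increment_bounds q_ge1 (V_gt0 t_ge0) VV.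
rewrite -lerBrDl (le_trans _ dVq)// -(powR_ratio q B_gt0 r_gt0).
rewrite [leLHS](_ : _ = q * (r * B) `^ (q - 1) * (c * B `^ (1 - q)));
  last by ring.
apply: ler_pM.
- by rewrite mulr_ge0 ?powR_ge0 ?ltW.
- by rewrite mulr_ge0 ?powR_ge0 ?ltW.
- rewrite ler_wpM2l ?(ltW q_gt0)// ge0_ler_powR ?nnegrE ?subr_ge0//.
    by rewrite mulr_ge0 ?ltW.
  exact/ltW/V_gt0.
- exact: V_unit_step_ge.
Qed.

Let V_unit_step : exists2 L : R, 0 < L &
  \forall t \near +oo, V (t + 1) <= V t + L.
Proof.
have [d d_gt0 yd] := y_away0.
exists (c * d `^ (1 - q)); first by rewrite mulr_gt0 ?powR_gt0.
near=> t.
have t_ge0 : 0 <= t by near: t; exact: nbhs_pinfty_ge (num_real _).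
rewrite -lerBlDl; apply: V_unit_step_le => //.
move=> s /andP[/ltW ts _]; move: s ts; near: t.
exact: near_pinfty_forall_ge.
Unshelve. all: end_near. Qed.

(** The a priori upper bound.  Each unit step either starts with [V t] above
[(t + 1)^(1/q)], in which case the perturbation is at most half of [V] and [V^q]
grows by at most [A], or it starts below, and then it ends below [A * (t + 1)]
since [V] grows by at most [L].  Both alternatives preserve a bound of the form
[D + A * t]. *)
Let Vq_le_linear : exists2 C : R, 0 < C &
  \forall t \near +oo, V t `^ q <= C * t.
Proof.
move: (q_ge1) (q_gt0) (b_gt0) (c_gt0) => q1 q0 b0 c0.
have [L L_gt0 VL] := V_unit_step.
pose A := c * q * (2 * (1 + L)) `^ (q - 1) + (1 + L) `^ q.
have A_large : c * q * (2 * (1 + L)) `^ (q - 1) <= A by rewrite lerDl powR_ge0.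
have A_small : (1 + L) `^ q <= A.
  by rewrite lerDr !mulr_ge0 ?powR_ge0 ?ltW.
have A_gt0 : 0 < A by apply: lt_le_trans A_small; rewrite powR_gt0//; lra.
clearbody A.
have [T [T_ge1 step]] : exists T : R, 1 <= T /\ forall t, T <= t ->
    V (t + 1) <= V t + L /\
    forall s, t <= s -> `|y s - V s| <= 2^-1 * s `^ b.
  have: \forall t \near +oo, 1 <= t /\ forall s, t <= s ->
      V (s + 1) <= V s + L /\
      forall r, s <= r -> `|y r - V r| <= 2^-1 * r `^ b.
    near=> t; split; first by near: t; exact: nbhs_pinfty_ge (num_real _).
    near: t; apply: near_pinfty_forall_ge.
    near=> t; split; near: t => //.
    by apply: near_pinfty_forall_ge; apply: y_near_V; lra.
  by move=> /pinfty_ex_gt0[T _ [? ?]]; exists T.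
exists (V (T + 1) `^ q + A); first by rewrite addr_gt0 ?powR_gt0 ?V_gt0//; lra.
suff bound t : T <= t -> V t `^ q <= V (T + 1) `^ q + A * t.
  near=> t; have tT : T <= t by near: t; exact: nbhs_pinfty_ge (num_real _).
  apply: le_trans (bound t tT) _; rewrite [leRHS]mulrDl lerD2r.
  by rewrite ler_peMr ?powR_ge0//; lra.
apply: (@unit_step_ind _ (fun t => V t `^ q <= V (T + 1) `^ q + A * t)) => {}t.
  move=> /andP[Tt tT]; rewrite -[leLHS]addr0 lerD//; last first.
    by rewrite mulr_ge0; lra.
  apply: ge0_ler_powR; rewrite ?nnegrE; [exact: ltW| | |apply: V_mono; lra].
    by apply/ltW/V_gt0; lra.
  by apply/ltW/V_gt0; lra.
move=> Tt Vt; have [VtL gsmall] := step _ Tt.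
have t_ge0 : 0 <= t by lra.
have Vt_gt0 := V_gt0 t_ge0.
have V1_gt0 : 0 < V (t + 1) by apply: V_gt0; lra.
have VV1 : V t <= V (t + 1) by apply: V_mono; lra.
have t1b : 1 <= (t + 1) `^ b.
  by rewrite -[leLHS](powRr0 (t + 1)) ler_powR ?(ltW b0)//; lra.
have [Vbig|Vsmall] := leP ((t + 1) `^ b) (V t).
- have yV r : t < r <= t + 1 -> V t / 2 <= y r.
    move=> /andP[tr rt].
    have rb : r `^ b <= (t + 1) `^ b.
      by rewrite ge0_ler_powR ?nnegrE ?(ltW b_gt0)//; lra.
    have := gsmall _ (ltW tr); rewrite ler_norml => /andP[+ _].
    have : V t <= V r by apply: V_mono; lra.
    lra.
  have LV : 0 <= L * (V t - 1) by apply: mulr_ge0; lra.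
  have : V (t + 1) `^ q <= V t `^ q + c * q * (2 * (1 + L)) `^ (q - 1).
    by apply: Vq_unit_step_le yV _ => //; lra.
  lra.
- have : V (t + 1) `^ q <= ((1 + L) * (t + 1) `^ b) `^ q.
    have : 0 <= L * ((t + 1) `^ b - 1) by apply: mulr_ge0; lra.
    by move=> LV; rewrite ge0_ler_powR ?nnegrE//; lra.
  rewrite powRM ?powR_ge0//; last by lra.
  rewrite root_powR; last by lra.
  move=> /le_trans; apply; apply: ler_wpDl; first exact: powR_ge0.
  by rewrite ler_wpM2r//; lra.
Unshelve. all: end_near. Qed.

(** Since [y] is at most [C1 * t^(1/q)] on [`]t / 2, t]], the growth of [V] over
this interval alone is at least a multiple of [t * t^((1 - q)/q) = t^(1/q)]. *)
Let V_ge_root : exists2 m : R, 0 < m & \forall t \near +oo, m * t `^ b <= V t.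
Proof.
move: (q_gt0) (b_gt0) => q0 b0.
have [C C_gt0 VC] := Vq_le_linear.
pose C1 := C `^ b + 1.
have C1_gt0 : 0 < C1 by rewrite ltr_wpDl ?powR_ge0.
exists (c * C1 `^ (1 - q) / 2); first by rewrite divr_gt0 ?mulr_gt0 ?powR_gt0.
near=> t.
have t_gt0 : 0 < t by near: t; exact: nbhs_pinfty_gt (num_real _).
have t2_ge0 : 0 <= t / 2 by lra.
have yt s : t / 2 < s <= t -> y s <= C1 * t `^ b.
  move=> /andP[/ltW ts st].
  have s_ge0 : 0 <= s by lra.
  have [VCs yVs] : V s `^ q <= C * s /\ `|y s - V s| <= 1 * s `^ b.
    move: s ts {st s_ge0}; near: t; apply: (@near_pinfty_div2 _
      [set u | forall s, u <= s ->
        V s `^ q <= C * s /\ `|y s - V s| <= 1 * s `^ b]).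
    by apply: near_pinfty_forall_ge; apply: filterI => //; exact: y_near_V.
  have sb : s `^ b <= t `^ b by rewrite ge0_ler_powR ?nnegrE// ltW.
  have Vs : V s <= C `^ b * s `^ b.
    rewrite -powRM ?(ltW C_gt0)//.
    rewrite -[leLHS](powR_root (ltW (V_gt0 s_ge0))).
    rewrite ge0_ler_powR ?nnegrE ?powR_ge0 ?(ltW b0)//.
    by rewrite mulr_ge0// (ltW C_gt0).
  rewrite mulrDl [1 * t `^ b]mul1r.
  have := ler_wpM2l (powR_ge0 C b) sb.
  move: yVs; rewrite ler_norml => /andP[_]; lra.
have V2 := V_gt0 t2_ge0.
have t2t : t / 2 <= t by lra.
have := V_step_ge t2_ge0 t2t yt.
rewrite powRM ?powR_ge0 ?(ltW C1_gt0)// -powRrM.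
have -> : t - t / 2 = t / 2 by field.
have tt : t `^ (b * (1 - q)) * t = t `^ b.
  rewrite -{2}(powRr1 (ltW t_gt0)) -powRD; last first.
    by rewrite (gt_eqF t_gt0) implybT.
  by congr (_ `^ _); rewrite mulrBr mulr1 bq subrK.
have -> : c * (C1 `^ (1 - q) * t `^ (b * (1 - q)) * (t / 2)) =
  c * C1 `^ (1 - q) / 2 * (t `^ (b * (1 - q)) * t) by field.
by rewrite tt; lra.
Unshelve. all: end_near. Qed.

(** The lower bound on [V] makes the perturbation negligible with respect to
[V]. *)
Let y_V_ratio r : 1 < r -> \forall t \near +oo, V t / r <= y t <= r * V t.
Proof.
move=> r_gt1; have r_gt0 : 0 < r by lra.
have [m m_gt0 mV] := V_ge_root.
have r1 : r^-1 < 1 by rewrite invf_lt1.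
(* So that an error of relative size [1 - r^-1] stays within the factor [r]
   above [V] as well as below it. *)
have rr : 2 <= r + r^-1.
  have : 0 <= (r - 1) ^+ 2 / r by rewrite divr_ge0 ?sqr_ge0// ltW.
  have -> : (r - 1) ^+ 2 / r = r + r^-1 - 2 by field; lra.
  lra.
have e_gt0 : 0 < m * (1 - r^-1) by rewrite mulr_gt0// subr_gt0.
near=> t.
have t_ge0 : 0 <= t by near: t; exact: nbhs_pinfty_ge (num_real _).
have Vt := V_gt0 t_ge0.
have : `|y t - V t| <= (1 - r^-1) * V t.
  apply: (@le_trans _ _ (m * (1 - r^-1) * t `^ b)).
    by near: t; exact: y_near_V.
  rewrite -mulrA mulrCA ler_wpM2l//; first by lra.
  by near: t.
rewrite ler_norml => /andP[lo up].
have := ler_wpM2r (ltW Vt) rr.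
by move=> ?; apply/andP; split; lra.
Unshelve. all: end_near. Qed.

Let V_unit_ratio r : 1 < r -> \forall t \near +oo, V (t + 1) <= r * V t.
Proof.
move=> r_gt1; move: (b_gt0) (q_gt0) => b0 q0.
have [m m_gt0 mV] := V_ge_root.
have [L L_gt0 VL] := V_unit_step.
have r1 : 0 < r - 1 by lra.
have Lrm : 0 < L / (r - 1) / m by rewrite !divr_gt0.
near=> t.
have t_big : (L / (r - 1) / m) `^ q <= t.
  by near: t; exact: nbhs_pinfty_ge (num_real _).
have tb : L / (r - 1) / m <= t `^ b.
  rewrite -[leLHS](powR_root (ltW Lrm)).
  by rewrite ge0_ler_powR ?nnegrE ?powR_ge0 ?(ltW b0)//
    (le_trans (powR_ge0 _ _) t_big).
have : L <= (r - 1) * V t.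
  rewrite mulrC -ler_pdivrMr//; apply: (@le_trans _ _ (m * t `^ b)).
    by rewrite -ler_pdivrMl// mulrC.
  by near: t.
have : V (t + 1) <= V t + L by near: t.
lra.
Unshelve. all: end_near. Qed.

(** On [`]t, t + 1]] the quantities [y] and [V] are comparable to [V t] up to
powers of [r], and [q - 1 <= 1] keeps the exponent of [r] at most [2]. *)
Let Vq_unit_step r : 1 < r -> \forall t \near +oo,
  V t `^ q + c * q * r ^- 2 <= V (t + 1) `^ q <= V t `^ q + c * q * r ^+ 2.
Proof.
move=> r_gt1; have r_gt0 : 0 < r by lra.
move: (q_ge1) (q_le2) => q1 q2.
have r2_ge1 : 1 <= r ^+ 2 by rewrite exprn_ege1 ?ltW.
have pow_r2 : (r ^+ 2) `^ (q - 1) <= r ^+ 2 by rewrite ler1_powR//; lra.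
have cq_ge0 : 0 <= c * q by rewrite mulr_ge0 ?ltW.
near=> t.
have t_ge0 : 0 <= t by near: t; exact: nbhs_pinfty_ge (num_real _).
have Vt := V_gt0 t_ge0.
have V1 : V (t + 1) <= r * V t by near: t; exact: V_unit_ratio.
have ratio s : t <= s -> V s / r <= y s <= r * V s.
  by move: s; near: t; apply/near_pinfty_forall_ge/y_V_ratio.
apply/andP; split.
- apply: (@le_trans _ _ (V t `^ q + c * q * (r ^- 2) `^ (q - 1))).
    rewrite lerD2l ler_wpM2l// ger1_powR//; last by lra.
    by rewrite invr_gt0 exprn_gt0//= invf_le1 ?exprn_gt0.
  apply: (@Vq_unit_step_ge _ (r ^+ 2 * V t)) => //.
  + by rewrite mulr_gt0 ?exprn_gt0.
  + by rewrite invr_gt0 exprn_gt0.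
  + move=> s /andP[ts st]; have /andP[_] := ratio s (ltW ts).
    move=> /le_trans; apply; rewrite expr2 -mulrA ler_pM2l//.
    by apply: le_trans V1; apply: V_mono; lra.
  + by rewrite mulKf// gt_eqF ?exprn_gt0.
- apply: (@le_trans _ _ (V t `^ q + c * q * (r ^+ 2) `^ (q - 1))).
    apply: (@Vq_unit_step_le _ (V t / r)) => //.
    + by rewrite divr_gt0.
    + by rewrite exprn_gt0.
    + move=> s /andP[ts st]; have /andP[+ _] := ratio s (ltW ts).
      apply: le_trans; rewrite ler_pM2r ?invr_gt0//; apply: V_mono; lra.
    + by rewrite expr2 mulrACA divff ?gt_eqF// mulr1.
  by rewrite lerD2l ler_wpM2l.
Unshelve. all: end_near. Qed.

(** The extra factor [r], with respect to the bounds on the increments, absorbs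
the additive constants for large [t]. *)
Let Vq_asymptotic r : 1 < r -> \forall t \near +oo,
  c * q * t / r ^+ 3 <= V t `^ q <= r ^+ 3 * (c * q * t).
Proof.
move=> r_gt1; have r_gt0 : 0 < r by lra.
have r1_gt0 : 0 < r - 1 by lra.
pose K := c * q; have K_gt0 : 0 < K by rewrite mulr_gt0.
rewrite -/K.
have [T [T_ge0 step]] : exists T : R, 0 <= T /\ forall t, T <= t ->
    V t `^ q + K * r ^- 2 <= V (t + 1) `^ q <= V t `^ q + K * r ^+ 2.
  have: \forall t \near +oo, 0 <= t /\ forall s, t <= s ->
    V s `^ q + K * r ^- 2 <= V (s + 1) `^ q <= V s `^ q + K * r ^+ 2.
    near=> t; split; first by near: t; exact: nbhs_pinfty_ge (num_real _).
    by near: t; apply/near_pinfty_forall_ge/Vq_unit_step.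
  by move=> /pinfty_ex_gt0[T _ [? ?]]; exists T.
clearbody K.
have r2_gt0 : 0 < r ^+ 2 by rewrite exprn_gt0.
have Kr_ge0 : 0 <= K * r ^+ 2 by apply/ltW/mulr_gt0.
have Krinv_ge0 : 0 <= K * r ^- 2 by rewrite ltW// mulr_gt0 ?invr_gt0.
have Vq_homo s t : 0 <= s -> s <= t -> V s `^ q <= V t `^ q.
  move=> s_ge0 st.
  rewrite ge0_ler_powR ?nnegrE ?(ltW q_gt0) ?V_mono// ltW ?V_gt0//.
  exact: le_trans st.
have up t : T <= t -> V t `^ q <= V (T + 1) `^ q + K * r ^+ 2 * (t - T).
  apply: (@unit_step_ind _
    (fun t => V t `^ q <= V (T + 1) `^ q + K * r ^+ 2 * (t - T))) => {}t.
    move=> /andP[Tt tT]; rewrite -[leLHS]addr0 lerD//; last first.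
      by rewrite (mulr_ge0 Kr_ge0)// subr_ge0.
    by apply: Vq_homo => //; exact: le_trans Tt.
  by move=> Tt; have /andP[_] := step t Tt; lra.
have lo t : T <= t -> K * r ^- 2 * (t - (T + 1)) <= V t `^ q.
  apply: (@unit_step_ind _
    (fun t => K * r ^- 2 * (t - (T + 1)) <= V t `^ q)) => {}t.
    move=> /andP[Tt tT]; apply: (@le_trans _ _ 0); last exact: powR_ge0.
    by rewrite mulr_ge0_le0 ?subr_le0.
  by move=> Tt; have /andP[+ _] := step t Tt; lra.
near=> t.
have tT : T <= t by near: t; exact: nbhs_pinfty_ge (num_real _).
apply/andP; split.
- apply: le_trans (lo _ tT).
  have -> : K * t / r ^+ 3 = K * r ^- 2 * (t / r).
    by rewrite exprS invfM; ring.
  rewrite ler_pM2l ?mulr_gt0 ?invr_gt0//.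
  have : (T + 1) * r / (r - 1) <= t.
    by near: t; exact: nbhs_pinfty_ge (num_real _).
  rewrite ler_pdivrMr// ler_pdivrMr// => h; lra.
- apply: le_trans (up _ tT) _.
  have : V (T + 1) `^ q / (K * r ^+ 2 * (r - 1)) <= t.
    by near: t; exact: nbhs_pinfty_ge (num_real _).
  rewrite ler_pdivrMr ?mulr_gt0//.
  have : 0 <= K * r ^+ 2 * T by rewrite (mulr_ge0 Kr_ge0).
  by rewrite exprS; lra.
Unshelve. all: end_near. Qed.

(** Taking the root of order [q >= 1] keeps the factor [r^3] for [V], and
passing from [V] to [y] costs one more [r]. *)
Lemma asymptotic_ratio r : 1 < r -> \forall t \near +oo,
  r ^- 4 <= y t / (c * q * t) `^ b <= r ^+ 4.
Proof.
move=> r_gt1; have r_gt0 : 0 < r by lra.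
near=> t.
have t_gt0 : 0 < t by near: t; exact: nbhs_pinfty_gt (num_real _).
have Vt := V_gt0 (ltW t_gt0).
have r3_ge1 : 1 <= r ^+ 3 by rewrite exprn_ege1 ?ltW.
have r3_gt0 : 0 < r ^+ 3 by rewrite exprn_gt0.
have r3b : (r ^+ 3) `^ b <= r ^+ 3 by rewrite ler1_powR.
have r3b_gt0 : 0 < (r ^+ 3) `^ b by rewrite powR_gt0.
have S_gt0 : 0 < c * q * t by rewrite !mulr_gt0.
have Sb_gt0 : 0 < (c * q * t) `^ b by rewrite powR_gt0.
have VqbE : V t = (V t `^ q) `^ b by rewrite powR_root// ltW.
have /andP[ly yu] : V t / r <= y t <= r * V t by near: t; exact: y_V_ratio.
have /andP[lV Vu] : c * q * t / r ^+ 3 <= V t `^ q <= r ^+ 3 * (c * q * t).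
  by near: t; exact: Vq_asymptotic.
have V_up : V t <= r ^+ 3 * (c * q * t) `^ b.
  apply: (@le_trans _ _ ((r ^+ 3) `^ b * (c * q * t) `^ b)); last first.
    by rewrite ler_pM2r.
  rewrite -powRM ?(ltW r3_gt0) ?(ltW S_gt0)// VqbE.
  rewrite ge0_ler_powR ?nnegrE ?powR_ge0 ?(ltW b_gt0)//.
  by rewrite mulr_ge0 ?(ltW r3_gt0) ?(ltW S_gt0).
have V_lo : (c * q * t) `^ b <= r ^+ 3 * V t.
  apply: (@le_trans _ _ ((r ^+ 3) `^ b * V t)); last by rewrite ler_pM2r.
  rewrite VqbE -powRM ?powR_ge0 ?(ltW r3_gt0)//.
  rewrite ge0_ler_powR ?nnegrE ?(ltW b_gt0) ?(ltW S_gt0)//.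
    by rewrite mulr_ge0 ?powR_ge0 ?(ltW r3_gt0).
  by rewrite -ler_pdivrMl// mulrC.
rewrite ler_pdivlMr// ler_pdivrMr//; apply/andP; split.
- apply: le_trans ly; rewrite ler_pdivrMl ?exprn_gt0//.
  by have -> : r ^+ 4 * (V t / r) = r ^+ 3 * V t by field; rewrite gt_eqF.
- by apply: (le_trans yu); rewrite exprS -[leRHS]mulrA ler_pM2l.
Unshelve. all: end_near. Qed.

End IncreasingPart.

(** * Convergence *)

Lemma limf_einf_gt0_near {R : realType} (y : R -> R) :
  (0 < limf_einf (fun t : R => (y t)%:E) (+oo)%R)%E ->
  exists2 d : R, 0 < d & \forall t \near +oo, d <= y t.
Proof.
rewrite limf_einfE => /ereal_sup_gt[_ [D Doo <-]] inf_gt0.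
have [d d_gt0 yd] : exists2 d : R, 0 < d & forall t, D t -> d <= y t.
  move E : (ereal_inf _) inf_gt0 => [d| |]// d_gt0.
    exists d => // t Dt; rewrite -lee_fin -E; apply: ereal_inf_lbound.
    by exists t.
  exists 1 => // t Dt; rewrite -lee_fin.
  have : (+oo <= (y t)%:E)%E by rewrite -E; apply: ereal_inf_lbound; exists t.
  by rewrite leye_eq.
by exists d => //; apply: filterS Doo.
Qed.

Lemma cvg_pinfty_ratio1 {R : realType} (u : R -> R) :
  (forall r, 1 < r -> \forall t \near +oo, r ^- 4 <= u t <= r ^+ 4) ->
  u t @[t --> +oo] --> (1 : R).
Proof.
move=> u_ratio; apply/cvgrPdist_le => /= e e_gt0.
(* Then [r ^+ 4 = 1 + e], and [r ^- 4 >= 1 - e]. *)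
pose r := (1 + e) `^ (4^-1).
have r4 : r ^+ 4 = 1 + e.
  rewrite /r -powR_mulrn ?powR_ge0// -powRrM mulVf// powRr1//.
  by rewrite addr_ge0 ?ltW.
have r_gt1 : 1 < r.
  have r_ge0 : 0 <= r by exact: powR_ge0.
  by rewrite -(@ltr_pXn2r _ 4)// ?nnegrE// expr1n r4 ltrDl.
near=> t.
have : r ^- 4 <= u t <= r ^+ 4 by near: t; exact: u_ratio.
rewrite r4 => /andP[lo up].
have inv_ge : 1 - e <= (1 + e)^-1.
  rewrite -[leRHS]mul1r ler_pdivlMr; last by lra.
  have := sqr_ge0 e; lra.
by rewrite ler_distlC; apply/andP; split; lra.
Unshelve. all: end_near. Qed.

Unset Implicit Arguments.
Set Strict Implicit.

Theorem theorem3p2 (R : realType) (c x alpha : R) (g y : R -> R)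
  (c_gt0 : 0 < c) (x_gt0 : 0 < x) (alphaN1_0 : -1 < alpha <= 0)
  (g_adm : measurable_locally_bounded g)
  (y_adm : measurable_locally_bounded y)
  (g_lim : g t / t `^ (1 / (1 - alpha)) @[t --> +oo] --> (0 : R))
  (y_gt0 : forall t : R, 0 <= t -> 0 < y t)
  (y_sol : is_solution x c alpha g y)
  (y_liminf : (0 < limf_einf (fun t : R => (y t)%:E) (+oo)%R)%E) :
  y t / (c * (1 - alpha) * t) `^ (1 / (1 - alpha)) @[t --> +oo] --> (1 : R).
Proof.
have /andP[alpha_gtN1 alpha_le0] := alphaN1_0.
have y_meas := y_adm.1.
have alphaE : 1 - (1 - alpha) = alpha by ring.
have q_ge1 : 1 <= 1 - alpha by lra.
have q_le2 : 1 - alpha <= 2 by lra.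
have powR_anti a b : 0 < a -> a <= b -> b `^ alpha <= a `^ alpha.
  move=> a_gt0 ab; rewrite -[alpha]opprK !(powRN _ (- alpha)).
  rewrite lef_pV2 ?posrE ?powR_gt0//; last exact: lt_le_trans ab.
  by rewrite ge0_ler_powR ?nnegrE//; lra.
have y_pos s t r : 0 <= s -> s < r <= t -> `|y r| = y r /\ 0 < y r.
  move=> s_ge0 /andP[sr _]; have r_ge0 : 0 <= r by lra.
  by have ? := y_gt0 _ r_ge0; rewrite gtr0_norm.
pose V t := y t - g t.
apply: cvg_pinfty_ratio1 => r r_gt1.
apply: (@asymptotic_ratio _ c (1 - alpha) V y) => //.
- move=> t t_ge0; rewrite /V; have := y_sol t t_ge0.
  have : (0 <= \int[completed_lebesgue_measure]_(s in `[0%R, t])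
                  (`|y s| `^ alpha)%:E)%E.
    by apply: integral_ge0 => s _; rewrite lee_fin powR_ge0.
  case: (integral _ _ _) => [a||]//; last by rewrite gt0_muley ?lte_fin.
  rewrite lee_fin => a_ge0 [->].
  by rewrite addrK ltr_wpDr// mulr_ge0 // ltW.
- move=> s t s_ge0 st; rewrite -subr_ge0 /V.
  have := solution_increment_ge c_gt0 y_meas y_sol s_ge0 st (lexx 0).
  by rewrite mul0r mulr0; apply => ? _; exact: powR_ge0.
- move=> s t B s_ge0 st B_gt0 yB; rewrite alphaE.
  apply: (solution_increment_le c_gt0 y_meas y_sol s_ge0 st) => z sz.
  by have [-> _] := y_pos _ _ _ s_ge0 sz; apply: powR_anti => //; exact: yB.
- move=> s t B s_ge0 st yB; rewrite alphaE.
  apply: (solution_increment_ge c_gt0 y_meas y_sol s_ge0 st).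
    exact: powR_ge0.
  move=> z sz; have [-> yz] := y_pos _ _ _ s_ge0 sz.
  by apply: powR_anti => //; exact: yB.
- exact: limf_einf_gt0_near.
- move=> e e_gt0; move/cvgrPdist_le : g_lim => /(_ e e_gt0) g_small.
  near=> t.
  have t_gt0 : 0 < t by near: t; exact: nbhs_pinfty_gt (num_real _).
  rewrite /V opprB addrC subrK.
  have : `|0 - g t / t `^ (1 / (1 - alpha))| <= e by near: t.
  rewrite sub0r normrN normrM normfV (gtr0_norm (powR_gt0 _ t_gt0)).
  by rewrite ler_pdivrMr ?powR_gt0.
Unshelve. all: end_near. Qed.
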